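(* Let $\mathbf{K}=(\mathbf{K}_n,\mu_n)_{n\in\mathbb{N}}$ be such that $T_{\mathbf{K}}$ is $\omega$-categorical, let $\mathcal{M}\models T_{\mathbf{K}}$, and assume that $(M,\mathrm{acl})$ is a pregeometry isomorphic to the pregeometry of a vector space over a finite field equipped with the linear span operator. Then there are $p,m\in\mathbb{Z}^+$ such that $p$ is prime and for each $n\in\mathbb{Z}^+$, $p^{mn}$ almost surely divides $|N|$ for $\mathcal{N}\in\mathbf{K}$.
   Context: Let $V$ be a finite relational vocabulary. For each $n\in\mathbb{N}$, $\mathbf{K}_n$ is a non-empty finite set of finite $V$-structures with a probability measure $\mu_n$. A property $P$ holds almost surely for $\mathcal{N}\in\mathbf{K}$ if $\lim_{n\to\infty}\mu_n(\{\mathcal{N}\in\mathbf{K}_n:\mathcal{N}\text{ has }P\})=1$. $T_{\mathbf{K}}$ is the set of sentences which are almost surely true. It is assumed that almost surely the size of structures in $\mathbf{K}$ grows, i.e. for each $m'$, almost surely $|N|\ge m'$. A theory is $\omega$-categorical if it has a unique countable model up to isomorphism (no finite models, exactly one countably infinite one). $N$ denotes the universe of $\mathcal{N}$. *)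

(* Defs.v *)
From HB Require Import structures.
From mathcomp Require Import all_boot all_order all_algebra.
From mathcomp Require Import all_classical all_reals all_analysis.
Set Implicit Arguments.
Unset Strict Implicit.
Unset Printing Implicit Defensive.
Import Order.TTheory GRing.Theory Num.Theory.
Import numFieldNormedType.Exports.
Local Open Scope classical_set_scope.
Local Open Scope ring_scope.

Record vocabulary := Vocabulary {
  symbol :> finType;
  arity : symbol -> nat }.

(* Empty universes are not excluded. *)
Record structure (V : vocabulary) := Structure {
  universe :> Type;
  interp : forall r : V, (arity r).-tuple universe -> Prop }.

Record finStructure (V : vocabulary) := FinStructure {
  finUniverse :> finType;
  finInterp : forall r : V, (arity r).-tuple finUniverse -> Prop }.

Definition structure_of_fin (V : vocabulary) (N : finStructure V) :
  structure V := Structure (@finInterp V N).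

Coercion structure_of_fin : finStructure >-> structure.

Definition isomorphic (V : vocabulary) (M N : structure V) : Prop :=
  exists2 f : M -> N, bijective f &
    forall (r : V) (t : (arity r).-tuple M),
      interp t <-> interp (map_tuple f t).

(* [formula V n] is the type of first-order formulas with equality whose free
   variables are among 0, ..., n - 1.  Under [All], variable 0 is the bound
   one and variable i of the context becomes i + 1. *)
Inductive formula (V : vocabulary) : nat -> Type :=
| Bot n : formula V n
| Eq n : 'I_n -> 'I_n -> formula V n
| Rel n (r : V) : (arity r).-tuple 'I_n -> formula V n
| Imp n : formula V n -> formula V n -> formula V n
| All n : formula V n.+1 -> formula V n.

Definition sentence (V : vocabulary) := formula V 0.

Fixpoint sat (V : vocabulary) (M : structure V) (n : nat) (phi : formula V n) :
    n.-tuple M -> Prop :=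
  match phi in formula _ k return k.-tuple M -> Prop with
  | Bot _ => fun _ => False
  | Eq _ i j => fun e => tnth e i = tnth e j
  | Rel _ r t => fun e => interp (map_tuple (tnth e) t)
  | Imp _ phi psi => fun e => sat phi e -> sat psi e
  | All _ phi => fun e => forall x : M, sat phi (cons_tuple x e)
  end.

Definition holds (V : vocabulary) (M : structure V) (phi : sentence V) : Prop :=
  sat phi ([tuple] : 0.-tuple M).

Definition theory (V : vocabulary) := sentence V -> Prop.

Definition models (V : vocabulary) (M : structure V) (T : theory V) : Prop :=
  forall phi : sentence V, T phi -> holds M phi.

Definition omega_categorical (V : vocabulary) (T : theory V) : Prop :=
  [/\ forall M : structure V, models M T -> infinite_set [set: M],
      exists2 M : structure V, models M T & countable [set: M] &
      forall M N : structure V, models M T -> models N T ->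
        countable [set: M] -> countable [set: N] -> isomorphic M N].

(* The finite sets K_n of finite structures, as finite families, each with a
   probability measure given by its point masses.  K_n is non-empty since the
   masses sum to 1. *)
Record random_structures (R : realType) (V : vocabulary) := RandomStructures {
  label : nat -> finType;
  member : forall n, label n -> finStructure V;
  mass : forall n, label n -> R;
  mass_ge0 : forall n (i : label n), 0 <= mass i;
  mass_sum1 : forall n, \sum_(i : label n) mass i = 1 }.

Definition prob (R : realType) (V : vocabulary) (K : random_structures R V)
    (n : nat) (P : finStructure V -> Prop) : R :=
  \sum_(i : label K n | `[< P (member i) >]) mass i.

Definition almost_surely (R : realType) (V : vocabulary)
    (K : random_structures R V) (P : finStructure V -> Prop) : Prop :=
  prob K n P @[n --> \oo] --> (1 : R).

Definition almost_sure_theory (R : realType) (V : vocabulary)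
    (K : random_structures R V) : theory V :=
  fun phi => almost_surely K (fun N => holds N phi).

(* Variable 0 of [phi] ranges over the universe; the others are filled by the
   parameters [a] from [A]. *)
Definition acl (V : vocabulary) (M : structure V) (A : set M) : set M :=
  [set b | exists n (phi : formula V n.+1) (a : n.-tuple M),
    [/\ forall i, A (tnth a i),
        finite_set [set x : M | sat phi (cons_tuple x a)] &
        sat phi (cons_tuple b a)]].

Definition pregeometry (T : Type) (cl : set T -> set T) : Prop :=
  [/\ forall A, A `<=` cl A /\ cl (cl A) = cl A,
      forall A B, A `<=` B -> cl A `<=` cl B,
      forall A x, cl A x -> exists B, [/\ finite_set B, B `<=` A & cl B x] &
      forall A x y, cl (A `|` [set y]) x -> ~ cl A x -> cl (A `|` [set x]) y].

Definition pregeometry_iso (T U : Type) (clT : set T -> set T)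
    (clU : set U -> set U) : Prop :=
  exists2 f : T -> U, bijective f & forall A, f @` clT A = clU (f @` A).

Definition linear_span (F : fieldType) (W : lmodType F) (A : set W) : set W :=
  [set v | exists n (c : 'I_n -> F) (w : 'I_n -> W),
    (forall i, A (w i)) /\ v = \sum_(i < n) c i *: w i].

(* Main.v *)
Require Import Defs.
From HB Require Import structures.
From mathcomp Require Import all_boot all_order all_algebra.
From mathcomp Require Import finfield.
From mathcomp Require Import all_classical all_reals all_analysis.

(** Write q for the order of the field, and fix k.  In M choose an independent
k-tuple a: its closure acl(a) has q^k points, and for each x outside acl(a)
the closure acl(x, a) has q^(k+1) points.  Since the closures acl(x, a) meet
pairwise in acl(a) or coincide, M is partitioned into acl(a) and sets
acl(x, a) \ acl(a) of size q^(k+1) - q^k.  All these sizes are multiples of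
q^k.  If the partition is first-order definable from a, then the existence of
a definable partition with these class sizes is a sentence true in M; it then
holds almost surely, and a finite structure satisfying it has a number of
points divisible by q^k.  With q = p^m this is the claim.

Two points need an argument.  First, some single formula must define acl(x, a)
for all x outside acl(a) at once (acl_uniformly_definable).  For each x some
formula does, namely any formula with exactly q^(k+1) solutions over (x, a);
finitely many formulas must suffice for all x.  Second, a sentence true in M
must hold almost surely.  Both are obtained from one ultraproduct B of members
of K, chosen along an ultrafilter which contains every almost sure property,
and which contains the failure of divisibility if divisibility is not almost
sure (counterexample_ultrafilter).  By Los's theorem B is a model of the
almost sure theory, and it is saturated enough for the finiteness claim
(ultraproduct_saturated).  Omega-categoricity enters through type_transfer: any
two models realise the same types of finite tuples, because their countable
elementary substructures are isomorphic.  So tuples move between M, where acl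
is understood, and B, where saturation and Los's theorem are available.  At
the end the partition sentence holds in almost all factors of B, against the
assumed failure of divisibility. *)

Set Implicit Arguments.
Unset Strict Implicit.
Unset Printing Implicit Defensive.

Local Open Scope classical_set_scope.

(** * Formulas: renaming, connectives, counting *)

Arguments Bot {V n}.
Arguments Eq {V n} i j : rename.

Section Formulas.
Variable V : vocabulary.

Lemma map_tuple_cons (A B : Type) (f : A -> B) n (x : A) (t : n.-tuple A) :
  map_tuple f (cons_tuple x t) = cons_tuple (f x) (map_tuple f t).
Proof. exact: val_inj. Qed.

Lemma map_tuple_comp (A B C : Type) (f : B -> C) (g : A -> B) n (t : n.-tuple A) :
  map_tuple f (map_tuple g t) = map_tuple (f \o g) t.
Proof. by apply: val_inj; rewrite /= -map_comp. Qed.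

Definition lift_vars n m (s : n.-tuple 'I_m) : n.-tuple 'I_m.+1 :=
  map_tuple (lift ord0) s.

Lemma map_tnth_up (A : Type) n m (s : n.-tuple 'I_m) (x : A) (e : m.-tuple A) :
  map_tuple (tnth (cons_tuple x e)) (lift_vars s) = map_tuple (tnth e) s.
Proof.
rewrite map_tuple_comp; apply: val_inj; apply: eq_map => i /=.
exact: (tnthS x e i).
Qed.

Lemma map_tnth_id (A : Type) m (e : m.-tuple A) :
  map_tuple (tnth e) (ord_tuple m) = e.
Proof. by apply: eq_from_tnth => i; rewrite tnth_map tnth_ord_tuple. Qed.

(** Renamings are tuples of variables, like the arguments of an atom, so that
the renamed formula is evaluated at a composite of tuples and the lemmas on
[map_tuple] above compute every environment that occurs below. *)
Fixpoint rename n (phi : formula V n) : forall m, n.-tuple 'I_m -> formula V m :=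
  match phi in formula _ k return forall m, k.-tuple 'I_m -> formula V m with
  | Bot _ => fun _ _ => Bot
  | Eq _ i j => fun _ s => Eq (tnth s i) (tnth s j)
  | Rel _ r t => fun _ s => Rel (map_tuple (tnth s) t)
  | Imp _ phi psi => fun _ s => Imp (rename phi s) (rename psi s)
  | All _ phi => fun _ s => All (rename phi (cons_tuple ord0 (lift_vars s)))
  end.

Lemma sat_rename (M : structure V) n (phi : formula V n) m (s : n.-tuple 'I_m)
    (e : m.-tuple M) :
  sat (rename phi s) e <-> sat phi (map_tuple (tnth e) s).
Proof.
elim: n / phi m s e => [n|n i j|n r t|n phi IHphi psi IHpsi|n phi IH] m s e //=.
- by rewrite !tnth_map.
- rewrite map_tuple_comp.
  suff -> : map_tuple (tnth e \o tnth s) t =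
            map_tuple (tnth (map_tuple (tnth e) s)) t by [].
  by apply: val_inj; apply: eq_map => i /=; rewrite tnth_map.
- by rewrite IHphi IHpsi.
- by split=> H x; [move/IH: (H x)|apply/IH; move: (H x)];
    rewrite map_tuple_cons map_tnth_up (tnth0 x e).
Qed.

Definition Not n (phi : formula V n) := Imp phi Bot.
Definition And n (phi psi : formula V n) := Not (Imp phi (Not psi)).
Definition Or n (phi psi : formula V n) := Imp (Not phi) psi.
Definition Ex n (phi : formula V n.+1) := Not (All (Not phi)).

Definition Iff n (phi psi : formula V n) := And (Imp phi psi) (Imp psi phi).

Lemma sat_And (M : structure V) n (phi psi : formula V n) (e : n.-tuple M) :
  sat (And phi psi) e <-> sat phi e /\ sat psi e.
Proof. by split => /= [H|]; [split; apply: contrapT|]; tauto. Qed.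

Lemma sat_Iff (M : structure V) n (phi psi : formula V n) (e : n.-tuple M) :
  sat (Iff phi psi) e <-> (sat phi e <-> sat psi e).
Proof. exact: sat_And. Qed.

Lemma sat_Or (M : structure V) n (phi psi : formula V n) (e : n.-tuple M) :
  sat (Or phi psi) e <-> sat phi e \/ sat psi e.
Proof. by split => /=; [case: (pselect (sat phi e))|]; tauto. Qed.

Lemma sat_Ex (M : structure V) n (phi : formula V n.+1) (e : n.-tuple M) :
  sat (Ex phi) e <-> exists x, sat phi (cons_tuple x e).
Proof.
split => [/= /existsNP [x /contrapT H]|[x H] /= /(_ x)]; last exact.
by exists x.
Qed.

Fixpoint BigOr n m (f : nat -> formula V n) : formula V n :=
  if m is m'.+1 then Or (BigOr m' f) (f m') else Bot.

Lemma sat_BigOr (M : structure V) n m (f : nat -> formula V n) (e : n.-tuple M) :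
  sat (BigOr m f) e <-> exists2 j, (j < m)%N & sat (f j) e.
Proof.
elim: m => [|m IH]; first by split => // -[].
apply: (iff_trans (sat_Or _ _ _)); rewrite IH; split => [[[j jm H]|H]|[j]].
- by exists j => //; exact: ltnW.
- by exists m.
- by rewrite ltnS leq_eqVlt => /orP [/eqP ->|jm] H; [right|left; exists j].
Qed.

(** A set has r + 1 points exactly when it has a point whose removal leaves r
points; this is the recursion of [eq_cardSP], and it needs only one fresh
variable at each stage. *)
Fixpoint Count n r (phi : formula V n.+1) : formula V n :=
  if r is r'.+1 then
    Ex (And phi (Count r'
      (And (rename phi (cons_tuple ord0 (lift_vars (lift_vars (ord_tuple n)))))
           (Not (Eq ord0 (lift ord0 ord0))))))
  else All (Not phi).

Lemma sat_Count (M : structure V) r n (phi : formula V n.+1) (e : n.-tuple M) :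
  sat (Count r phi) e <-> ([set x | sat phi (cons_tuple x e)] #= `I_r)%card.
Proof.
elim: r n phi e => [|r IH] n phi e.
  rewrite II0 card_eq0 /=; split => [H|/eqP/seteqP [H _] x]; last exact: H.
  by apply/eqP; rewrite -subset0 => x; apply: H.
apply: (iff_trans (sat_Ex _ _)).
have E x : [set y | sat (And (rename phi (cons_tuple ord0 (lift_vars (lift_vars (ord_tuple n)))))
    (Not (Eq ord0 (lift ord0 ord0)))) (cons_tuple y (cons_tuple x e))] =
    [set y | sat phi (cons_tuple y e)] `\ x.
  apply/seteqP; split => y; rewrite /mkset sat_And sat_rename map_tuple_cons
    !map_tnth_up map_tnth_id /=;
  by rewrite (tnth0 y (cons_tuple x e)) (tnthS y (cons_tuple x e) ord0) (tnth0 x e).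
split => [[x /sat_And [H1 /IH H2]]|/eq_cardSP [x H1 H2]].
  by apply/eq_cardSP; exists x => //; move: H2; rewrite E.
exists x.
by apply/sat_And; split => //; apply/IH; rewrite E.
Qed.

End Formulas.

(** * Elementary substructures and transfer of types *)

Section Lowenheim_Skolem.
Variable V : vocabulary.

Definition atom n : countType :=
  ('I_n * 'I_n + {r : V & (arity r).-tuple 'I_n})%type.

(** Countability of formulas is only used as an enumeration, so a surjection
from a countable type is enough; atoms sit at the leaves, encoded by their
pickle, and ill-formed trees are read as [Bot]. *)
Fixpoint decode_formula (t : GenTree.tree nat) n : formula V n :=
  match t with
  | GenTree.Leaf c =>
      match unpickle c : option (atom n) with
      | Some (inl ij) => Eq ij.1 ij.2
      | Some (inr rt) => Rel (tagged rt)
      | None => Bot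
      end
  | GenTree.Node 0 [:: a; b] => Imp (decode_formula a n) (decode_formula b n)
  | GenTree.Node 1 [:: a] => All (decode_formula a n.+1)
  | _ => Bot
  end.

Lemma decode_formula_surj n (phi : formula V n) : exists t, decode_formula t n = phi.
Proof.
elim: n / phi => [n|n i j|n r t|n _ [a <-] _ [b <-]|n _ [a <-]].
- by exists (GenTree.Node 0 [::]).
- by exists (GenTree.Leaf (pickle (inl (i, j) : atom n))); rewrite /= pickleK.
- exists (GenTree.Leaf (pickle (inr (Tagged (fun r : V => (arity r).-tuple 'I_n) t)
    : atom n))); by rewrite /= pickleK.
- by exists (GenTree.Node 0 [:: a; b]).
- by exists (GenTree.Node 1 [:: a]).
Qed.

(** The arity n is existential here because the index c of a formula and the
list s of parameters are untyped; it is recovered as the size of s. *)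
Definition counterexample (M : structure V) (c : nat) (s : seq M) (x : M) : Prop :=
  exists2 t, unpickle c = Some t &
    exists n (e : n.-tuple M), tval e = s /\ ~ sat (decode_formula t n.+1) (cons_tuple x e).

Definition witness (M : structure V) (x0 : M) (c : nat) (s : seq M) : M :=
  if pselect (exists x, counterexample c s x) is left h then projT1 (cid h)
  else x0.

Lemma witnessP (M : structure V) (x0 : M) t n (e : n.-tuple M) (x : M) :
  ~ sat (decode_formula t n.+1) (cons_tuple x e) ->
  ~ sat (decode_formula t n.+1) (cons_tuple (witness x0 (pickle t) e) e).
Proof.
move=> nsat; rewrite /witness; case: pselect => [h|[]]; last first.
  by exists x, t; [exact: pickleK | exists n, e].
case: (cid h) => {h}y /= [t']; rewrite pickleK => -[<-] [n' [e' [ee' H]]].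
have en : n' = n by rewrite -(size_tuple e) -ee' size_tuple.
by subst n'; rewrite -(val_inj ee').
Qed.

(** Leaves name the parameters a, and the node c applies the Skolem function of
the formula with index c.  The values form the Skolem hull of a, and they are
countably many because there are countably many trees. *)
Fixpoint skolem (M : structure V) (x0 : M) (a : seq M) (t : GenTree.tree nat) : M :=
  match t with
  | GenTree.Leaf i => nth x0 a i
  | GenTree.Node c ts => witness x0 c (map (skolem x0 a) ts)
  end.

(** The Skolem hull of a is elementary: a failing universal formula with
parameters in the hull fails at the witness chosen for it, which is the value
of the tree with that formula at the root. *)
Lemma lowenheim_skolem (M : structure V) (x0 : M) k (a : k.-tuple M) :
  exists (N : structure V) (h : N -> M),
    [/\ countable [set: N],
        forall n (phi : formula V n) (e : n.-tuple N),
          sat phi e <-> sat phi (map_tuple h e) &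
        exists b, map_tuple h b = a].
Proof.
pose U := {x : M | exists t, skolem x0 a t = x}.
pose N := @Structure V U (fun r t => interp (map_tuple sval t)).
pose h : N -> M := sval.
have h_inj : injective h by move=> [x px] [y py] /= exy; exact: eq_exist.
have treeP (x : N) : {t | skolem x0 a t = h x} by apply: cid; exact: (svalP x).
have inN t : exists x : N, h x = skolem x0 a t.
  by exists (exist _ (skolem x0 a t) (ex_intro _ t erefl)).
exists N, h; split.
- apply/countable_injP; exists (fun x => pickle (sval (treeP x))) => x y _ _.
  move=> /(pcan_inj pickleK) exy; apply: h_inj.
  by have := svalP (treeP y); rewrite -exy (svalP (treeP x)).
- move=> n phi; elim: n / phi => [n|n i j|n r t|n p IHp q IHq|n p IH] e //=.
  + by rewrite !tnth_map; split => [->//|/h_inj].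
  + suff -> : map_tuple (tnth (map_tuple h e)) t = map_tuple sval (map_tuple (tnth e) t) by [].
    rewrite map_tuple_comp; apply: val_inj; apply: eq_map => i /=.
    by rewrite tnth_map.
  + by rewrite IHp IHq.
  + split => H x; last by apply/IH; rewrite map_tuple_cons.
    apply: contrapT; have [t pE] := decode_formula_surj p; rewrite -{}pE in IH H * => nsat.
    have := witnessP (x0 := x0) nsat.
    have -> : witness x0 (pickle t) (map_tuple h e) =
        skolem x0 a (GenTree.Node (pickle t) (map (fun x => sval (treeP x)) e)).
      congr (witness _ _ _); rewrite -map_comp; apply: eq_map => y /=.
      exact/esym/(svalP (treeP y)).
    have [y <-] := inN (GenTree.Node (pickle t) (map (fun x => sval (treeP x)) e)).
    by case; rewrite -map_tuple_cons; apply/IH; exact: H.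
- exists (map_tuple (fun i : 'I_k => sval (cid (inN (GenTree.Leaf (val i))))) (ord_tuple k)).
  rewrite map_tuple_comp; apply: eq_from_tnth => i.
  rewrite tnth_map tnth_ord_tuple /=; case: cid => x /= ->.
  by rewrite (tnth_nth x0).
Qed.

(** A countable elementary substructure of A containing t is isomorphic to a
countable elementary substructure of B; the image of t is the required
tuple. *)
Lemma type_transfer (T : theory V) (A B : structure V) k (t : k.-tuple A) :
  omega_categorical T -> models A T -> models B T ->
  exists t' : k.-tuple B, forall phi : formula V k, sat phi t <-> sat phi t'.
Proof.
move=> [noFin _ uniq] AT BT.
have inh (C : structure V) : models C T -> exists x : C, True.
  by move=> /noFin/infinite_setN0 [x _]; exists x.
have [x0 _] := inh A AT; have [y0 _] := inh B BT.
have [A0 [f [cA0 elA [a <-]]]] := lowenheim_skolem x0 t.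
have [B0 [g [cB0 elB _]]] := lowenheim_skolem y0 [tuple].
have holdsE (C C0 : structure V) (h : C0 -> C) :
    (forall n (phi : formula V n) (e : n.-tuple C0), sat phi e <-> sat phi (map_tuple h e)) ->
    models C T -> models C0 T.
  move=> el CT phi /CT; rewrite /holds el.
  by have -> : map_tuple h [tuple] = [tuple] by exact: val_inj.
have [i [j ij ji] iP] := uniq _ _ (holdsE _ _ _ elA AT) (holdsE _ _ _ elB BT) cA0 cB0.
have el n (phi : formula V n) (e : n.-tuple A0) : sat phi e <-> sat phi (map_tuple i e).
  elim: n / phi e => [n|n u v|n r u|n p IHp q IHq|n p IH] e //=.
  - by rewrite !tnth_map; split => [->//|/(can_inj ij)].
  - rewrite iP map_tuple_comp.
    suff -> : map_tuple (i \o tnth e) u = map_tuple (tnth (map_tuple i e)) u by [].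
    by apply: val_inj; apply: eq_map => l /=; rewrite tnth_map.
  - by rewrite IHp IHq.
  - split => H x; last by apply/IH; rewrite map_tuple_cons.
    by rewrite -(ji x) -map_tuple_cons; apply/IH.
by exists (map_tuple g (map_tuple i a)) => phi; rewrite -elA -elB el.
Qed.

End Lowenheim_Skolem.

(** * Ultraproducts *)

Section Ultraproduct.
Variables (V : vocabulary) (I : Type) (N : I -> structure V) (pt : forall i, N i).
Variables (U : set_system I) (UU : UltraFilter U).

(** A point is an equivalence class of choice functions, as a set of functions;
[coordinate] reads a point through one representative of its class. *)
Definition ultra_universe : Type :=
  {P : set (forall i, N i) | exists g, P = [set f | U [set i | f i = g i]]}.

Definition coordinate i (x : ultra_universe) : N i := sval (cid (svalP x)) i.

Definition ultraproduct : structure V :=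
  @Structure V ultra_universe
    (fun r t => U [set i | interp (map_tuple (@coordinate i) t)]).

Lemma coordinate_inj (x y : ultraproduct) :
  U [set i | coordinate i x = coordinate i y] -> x = y.
Proof.
rewrite /coordinate; case: x y => [P Pg] [Q Qg] /=.
case: cid => /= g Pe; case: cid => /= h Qe gh.
apply: eq_exist; rewrite Pe Qe; apply/seteqP; split => f /= fg.
  by apply: filterS2 fg gh => i /= -> ->.
by apply: filterS2 fg gh => i /= -> <-.
Qed.

Lemma coordinate_surj (g : forall i, N i) :
  exists x : ultraproduct, U [set i | coordinate i x = g i].
Proof.
exists (exist _ [set f | U [set i | f i = g i]] (ex_intro _ g erefl)).
rewrite /coordinate; case: cid => /= h /seteqP [H _]; have /H : [set f | U [set i | f i = g i]] g.
  by apply: filterS filterT => i.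
by apply: filterS => i /= ->.
Qed.

Lemma ultraC (A : set I) : ~ U A -> U (~` A).
Proof. by move=> nA; case: (in_ultra_setVsetC A UU). Qed.

(** By induction on formulas.  For a universal formula, if it fails in
almost all factors, then choosing a failing element in each of them gives a
point of the ultraproduct at which the instance fails. *)
Lemma Los n (phi : formula V n) (e : n.-tuple ultraproduct) :
  sat phi e <-> U [set i | sat phi (map_tuple (@coordinate i) e)].
Proof.
elim: n / phi e => [n|n u v|n r t|n p IHp q IHq|n p IH] e /=.
- by split => // /filter_ex [].
- split => [uv|H]; first by apply: filterS filterT => i /=; rewrite !tnth_map uv.
  by apply: coordinate_inj; apply: filterS H => i /=; rewrite !tnth_map.
- suff E : [set i | interp (map_tuple (@coordinate i) (map_tuple (tnth e) t))] =
    [set i | interp (map_tuple (tnth (map_tuple (@coordinate i) e)) t)] by rewrite E.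
  apply/funext => i /=; rewrite map_tuple_comp; congr (interp _).
  by apply: val_inj; apply: eq_map => j /=; rewrite tnth_map.
- rewrite IHp IHq; split => [H|H Hp]; last by apply: filterS2 H Hp => i /=; exact.
  have [/H|/ultraC] := pselect (U [set i | sat p (map_tuple (@coordinate i) e)]).
    by apply: filterS => i /= qi _.
  by apply: filterS => i /= np /np.
- split => H; last first.
    by move=> x; apply/IH; apply: filterS H => i /= /(_ (coordinate i x));
      rewrite map_tuple_cons.
  apply: contrapT => /ultraC nH.
  have [g gP] : {g : forall i, N i | forall i,
      ~ (forall x, sat p (cons_tuple x (map_tuple (@coordinate i) e))) ->
      ~ sat p (cons_tuple (g i) (map_tuple (@coordinate i) e))}.
    suff H0 i : exists x : N i, ~ (forall x, sat p (cons_tuple x (map_tuple (@coordinate i) e))) ->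
        ~ sat p (cons_tuple x (map_tuple (@coordinate i) e)).
      by exists (fun i => sval (cid (H0 i))) => i; exact: svalP (cid (H0 i)).
    have [a|/existsNP [x nx]] := pselect
      (forall x, sat p (cons_tuple x (map_tuple (@coordinate i) e))); last by exists x.
    by exists (pt i).
  have [x xg] := coordinate_surj g.
  have /IH Hx := H x.
  have [i /= [[h1 h2] h3]] := filter_ex (filterI (filterI xg nH) Hx).
  by move: h3; rewrite map_tuple_cons h1; exact: gP h2.
Qed.

(** In factor i take an element satisfying as many initial conditions as
possible, but look at no more than [rho i] of them.  Each psi_j is then
satisfied wherever the first j + 1 conditions are jointly satisfiable and
[rho i] exceeds j, which is almost everywhere. *)
Lemma ultraproduct_saturated (rho : I -> nat) k (b : k.-tuple ultraproduct)
    (psi : nat -> formula V k.+1) :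
  (forall m, U [set i | (m <= rho i)%N]) ->
  (forall m, exists x, forall j, (j < m)%N -> sat (psi j) (cons_tuple x b)) ->
  exists x, forall j, sat (psi j) (cons_tuple x b).
Proof.
move=> rhoU fsat.
pose S i m := exists y : N i, forall j, (j < m)%N ->
  sat (psi j) (cons_tuple y (map_tuple (@coordinate i) b)).
have SU m : U [set i | S i m].
  have [x xP] := fsat m.
  suff : U [set i | forall j, (j < m)%N ->
      sat (psi j) (cons_tuple (coordinate i x) (map_tuple (@coordinate i) b))].
    by apply: filterS => i /= H; exists (coordinate i x).
  elim: m xP => [|m IH] xP; first by apply: filterS filterT.
  have /Los Hm := xP m (ltnSn m).
  apply: filterS2 (IH (fun j jm => xP j (ltnW jm))) Hm => i /= H1.
  rewrite map_tuple_cons => H2 j; rewrite ltnS leq_eqVlt => /orP [/eqP ->|] //.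
  exact: H1.
have [g gP] : {g : forall i, N i | forall i m, (m <= rho i)%N -> S i m ->
    forall j, (j < m)%N -> sat (psi j) (cons_tuple (g i) (map_tuple (@coordinate i) b))}.
  suff H0 i : exists y : N i, forall m, (m <= rho i)%N -> S i m ->
      forall j, (j < m)%N -> sat (psi j) (cons_tuple y (map_tuple (@coordinate i) b)).
    by exists (fun i => sval (cid (H0 i))) => i; exact: svalP (cid (H0 i)).
  have exS : exists m, `[< (m <= rho i)%N /\ S i m >].
    by exists 0; apply/asboolP; split => //; exists (pt i).
  have ubS m : `[< (m <= rho i)%N /\ S i m >] -> (m <= rho i)%N by move=> /asboolP [].
  have [m /asboolP [mr [y yP]] mmax] := ex_maxnP exS ubS.
  exists y => m' m'r Sm' j jm'; apply: yP; apply: leq_trans jm' _.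
  by apply: mmax; apply/asboolP.
have [x xg] := coordinate_surj g.
exists x => j; apply/Los; apply: filterS2 (filterI xg (rhoU j.+1)) (SU j.+1) => i /= -[xe ji] Sij.
by rewrite map_tuple_cons xe; apply: gP ji Sij _ (ltnSn j).
Qed.

End Ultraproduct.

(** * Ultrafilters containing all almost sure properties *)

Section AlmostSurely.
Import Order.TTheory GRing.Theory Num.Theory numFieldNormedType.Exports.
Local Open Scope ring_scope.
Variables (R : realType) (V : vocabulary) (K : random_structures R V).
Implicit Types P Q D : finStructure V -> Prop.

Lemma prob_le1 n P : prob K n P <= 1.
Proof.
rewrite -(mass_sum1 K n) /prob big_mkcond; apply: ler_sum => i _.
by case: ifP => // _; exact: mass_ge0.
Qed.

Lemma almost_surely_squeeze (f : nat -> R) P :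
  f n @[n --> \oo] --> (1 : R) ->
  (\forall n \near \oo, f n <= prob K n P) -> almost_surely K P.
Proof.
move=> f1 fP; apply: (@squeeze_cvgr _ _ _ _ f (cst 1)) => //; last exact: cvg_cst.
by near=> n; rewrite prob_le1 andbT; near: n.
Unshelve. all: by end_near.
Qed.

Lemma almost_surelyI P Q :
  almost_surely K P -> almost_surely K Q -> almost_surely K (fun N => P N /\ Q N).
Proof.
move=> asP asQ; apply: (@almost_surely_squeeze (fun n => prob K n P + prob K n Q - 1)).
  suff -> : nbhs (1 : R) = nbhs (1 + 1 - 1 : R).
    exact: cvgB (cvgD asP asQ) (@cvg_cst _ _ _ _ _).
  by rewrite addrK.
apply: nearW => n; rewrite lerBlDr -(mass_sum1 K n) /prob !(big_mkcond (fun _ => `[< _ >])).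
rewrite -!big_split /=; apply: ler_sum => i _; have m0 := mass_ge0 (r := K) i.
case: asboolP => p; case: asboolP => q; case: asboolP => pq;
  rewrite ?addr0 ?add0r //; tauto || exact: addr_ge0.
Qed.

(** If P implied D in every member of K_n from some n on, then D would be at
least as probable as P there, hence almost sure. *)
Lemma almost_surely_not_refuted P D (m : nat) :
  almost_surely K P -> ~ almost_surely K D ->
  exists n (l : label K n), [/\ (m <= n)%N, P (member l) & ~ D (member l)].
Proof.
move=> asP nD; apply: contrapT => H; apply: nD.
apply: almost_surely_squeeze asP _; exists m => // n /= mn.
rewrite /prob !(big_mkcond (fun _ => `[< _ >])); apply: ler_sum => i _.
case: asboolP => p; case: asboolP => d //; last exact: mass_ge0.
by case: H; exists n, i.
Qed.

(** The sets that contain all members of K_n satisfying P and refuting D, for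
some almost sure P and all n from some point on, form a proper filter; any
ultrafilter above it will do.  The function rho records n, and empty members
are left out of the index set so that choice functions exist. *)
Lemma counterexample_ultrafilter D :
  (forall k : nat, almost_surely K (fun N => k <= #|N|)%N) -> ~ almost_surely K D ->
  exists (I : Type) (N : I -> finStructure V) (rho : I -> nat) (U : set_system I),
    [/\ UltraFilter U, inhabited (forall i, N i),
        forall m, U [set i | (m <= rho i)%N],
        U [set i | ~ D (N i)] &
        forall P, almost_surely K P -> U [set i | P (N i)]].
Proof.
move=> grow nD.
pose I := {i : {n : nat & label K n} | (0 < #|member (tagged i)|)%N}.
pose N (i : I) := member (tagged (val i)).
pose rho (i : I) := tag (val i).
pose G : set_system I := [set A | exists P (m : nat), almost_surely K P /\
  forall i, P (N i) -> (m <= rho i)%N -> ~ D (N i) -> A i].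
have GP P : almost_surely K P -> G [set i | P (N i)] by move=> asP; exists P, 0.
pose always (_ : finStructure V) : Prop := (0 <= 0)%N.
have as0 : almost_surely K always by exact: grow 0.
have PG : ProperFilter G.
  split.
    move=> [P [m [asP H]]].
    have [n [l [mn [Pl l0] nDl]]] :=
      almost_surely_not_refuted m (almost_surelyI asP (grow 1)) nD.
    exact: (H (exist _ (existT _ n l) l0)).
  split.
  - by exists always, 0; split.
  - move=> A B [P [m [asP HP]]] [Q [m' [asQ HQ]]].
    exists (fun N => P N /\ Q N), (maxn m m'); split; first exact: almost_surelyI.
    by move=> i [Pi Qi]; rewrite geq_max => /andP [mi mi'] nDi; split;
      [exact: HP | exact: HQ].
  - by move=> A B AB [P [m [asP HP]]]; exists P, m; split => // i ? ? ?; apply/AB/HP.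
have [U [UU GU]] := ultraFilterLemma PG.
exists I, N, rho, U; split => //.
- by constructor => i; have /card_gt0P/sigW [x _] := valP i; exact: x.
- by move=> m; apply: GU; exists always, m; split.
- by apply: GU; exists always, 0; split.
- by move=> P /GP /GU.
Qed.

End AlmostSurely.

(** * Counting finite sets *)

Section FiniteCardinals.
Local Open Scope card_scope.

Lemma card_eq_pred (J : finType) (P : pred J) : [set j | P j] #= `I_#|P|.
Proof.
move En : #|P| => n; elim: n P En => [|n IH] P En.
  rewrite II0 card_eq0; apply/eqP; rewrite -subset0 => j /= Pj.
  by have := card0_eq En j; rewrite inE => /= E; rewrite -topredE /= Pj in E.
have [j Pj] : exists j, P j by apply/existsP; rewrite -[[exists _, _]]/(~~ pred0b P) -lt0n En.
apply/eq_cardSP; exists j => //.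
have := IH [pred i | P i & i != j].
have -> : [set i | P i] `\ j = [set i | [pred i | P i & i != j] i].
  by apply/seteqP; split => i /=; [case=> -> /eqP ->|case/andP=> -> /eqP].
apply; apply/eqP; rewrite -eqSS -En (cardD1 j P) unfold_in Pj add1n eqSS.
by apply/eqP/eq_card => i; rewrite !inE andbC.
Qed.

(** Counting inside an injective enumeration of an ambient set moves
cardinalities of subsets to finite types, where complements can be counted. *)
Lemma card_eq_preimage (J : finType) (T : Type) (e : J -> T) (A : set T) :
  injective e -> A `<=` range e -> A #= `I_#|[pred j | `[< A (e j) >]]|.
Proof.
move=> inje Ae.
have {1}-> : A = e @` [set j | [pred j | `[< A (e j) >]] j].
  apply/seteqP; split => x /=; last by move=> [j /asboolP Aj <-].
  by move=> Ax; have [j _ ej] := Ae x Ax; exists j => //; apply/asboolP; rewrite ej.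
have eS := card_eq_pred [pred j | `[< A (e j) >]].
by apply: card_eq_trans _ eS; apply: inj_card_eq => i j _ _; exact: inje.
Qed.

Lemma card_eq_range (J : finType) (T : Type) (e : J -> T) :
  injective e -> range e #= `I_#|J|.
Proof.
move=> inje; have := card_eq_preimage inje (@subset_refl _ (range e)).
suff -> : #|[pred j | `[< range e (e j) >]]| = #|J| by [].
by apply: eq_card => j; rewrite !inE; apply/asboolP; exists j.
Qed.

Lemma card_eq_enum (T : Type) (A : set T) n :
  A #= `I_n -> exists2 e : 'I_n -> T, injective e & range e = A.
Proof.
move=> An; have /card_bijP [f [g fg gf]] := card_eq_trans An card_II.
pose h (j : 'I_n) : [set: 'I_n] := SigSub (mem_set (I : [set: 'I_n] j)).
exists (fun j => val (g (h j))) => [i j /val_inj/(can_inj gf)/(congr1 val) //|].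
apply/seteqP; split => [x [j _ <-]|x Ax]; first exact: set_valP.
exists (val (f (SigSub (mem_set Ax)))) => //.
suff -> : h (val (f (SigSub (mem_set Ax)))) = f (SigSub (mem_set Ax)) by rewrite fg.
exact: val_inj.
Qed.

Lemma card_eq_finType (J : finType) (P : pred J) n : [set j | P j] #= `I_n -> #|P| = n.
Proof.
by move=> Pn; apply/card_eq_II; apply: card_eq_trans Pn; rewrite card_eq_sym card_eq_pred.
Qed.

Lemma card_eq_uniq (T : Type) (A : set T) m n : A #= `I_m -> A #= `I_n -> m = n.
Proof.
by move=> Am An; apply/card_eq_II; apply: card_eq_trans An; rewrite card_eq_sym.
Qed.

Lemma card_eq_sub (T : Type) (A B : set T) m n :
  A `<=` B -> A #= `I_m -> B #= `I_n -> (m <= n)%N.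
Proof.
move=> AB Am /card_eq_enum [e inje eB]; rewrite -eB in AB.
rewrite (card_eq_uniq Am (card_eq_preimage inje AB)) -[leqRHS]card_ord.
exact: max_card.
Qed.

Lemma card_eqD (T : Type) (A B : set T) m n :
  A `<=` B -> A #= `I_m -> B #= `I_n -> B `\` A #= `I_(n - m).
Proof.
move=> AB Am /card_eq_enum [e inje eB]; rewrite -eB in AB *.
have := card_eq_preimage inje (@subDsetl _ (range e) A).
rewrite (card_eq_uniq Am (card_eq_preimage inje AB)).
suff -> : #|[pred j | `[< (range e `\` A) (e j) >]]| =
  (n - #|[pred j | `[< A (e j) >]]|)%N by [].
have nE := cardC [pred j | `[< A (e j) >]]; rewrite card_ord in nE.
rewrite -[X in (X - _)%N]nE addKn.
apply: eq_card => j; rewrite !inE; apply/asboolP/asboolPn => [[]//|nA].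
by split => //; exists j.
Qed.

Lemma card_eq_subset_eq (T : Type) (A B : set T) n :
  A `<=` B -> A #= `I_n -> B #= `I_n -> A = B.
Proof.
move=> AB An Bn; have := card_eqD AB An Bn; rewrite subnn II0 card_eq0.
by move=> /eqP /subsets_disjoint BA; apply/seteqP.
Qed.

End FiniteCardinals.

(** * Sizes of linear spans over a finite field *)

Section Span.
Import GRing.Theory.
Local Open Scope ring_scope.
Local Open Scope card_scope.
Variables (F : finFieldType) (W : lmodType F).
Implicit Types A : set W.

Lemma span_sub A : A `<=` linear_span A.
Proof.
by move=> w Aw; exists 1%N, (fun _ => 1), (fun _ => w); split => //; rewrite big_ord1 scale1r.
Qed.

Lemma span_linear A (c : F) v w :
  linear_span A v -> linear_span A w -> linear_span A (c *: v + w).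
Proof.
move=> [n [a [x [Ax ->]]]] [m [b [y [Ay ->]]]].
exists (n + m)%N,
  (fun i : 'I_(n + m) =>
     match fintype.split i with inl j => c * a j | inr j => b j end),
  (fun i : 'I_(n + m) => match fintype.split i with inl j => x j | inr j => y j end); split.
  by move=> i; case: splitP.
rewrite big_split_ord /= scaler_sumr; congr (_ + _); apply: eq_bigr => i _.
  by rewrite (unsplitK (inl i)) scalerA.
by rewrite (unsplitK (inr i)).
Qed.

Lemma span0 A : linear_span A 0.
Proof.
exists 0%N, (fun _ => 0), (fun _ => 0); rewrite big_ord0; split => // i.
by case: i.
Qed.

Lemma spanU1 A x :
  linear_span (A `|` [set x]) = [set c *: x + v | c in [set: F] & v in linear_span A].
Proof.
apply/seteqP; split => [_ [n [c [w [Aw ->]]]]|_ [c _ [v Av <-]]]; last first.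
  apply: span_linear; first by apply: span_sub; right.
  by case: Av => n [a [y [Ay ->]]]; exists n, a, y; split => // i; left.
elim: n c w Aw => [|n IH] c w Aw.
  by exists 0 => //; exists 0; rewrite ?big_ord0 ?scale0r ?addr0 //; exact: span0.
rewrite big_ord_recl; have [d _ [v Av <-]] := IH (c \o lift ord0) (w \o lift ord0) (fun i => Aw _).
have [Aw0|->] := Aw ord0.
  exists d => //; exists (c ord0 *: w ord0 + v); last by rewrite addrCA.
  by apply: span_linear => //; exact: span_sub.
by exists (c ord0 + d) => //; exists v => //; rewrite scalerDl addrA.
Qed.

Lemma card_span0 : linear_span (set0 : set W) #= `I_1.
Proof.
suff -> : linear_span (set0 : set W) = [set 0] by exact: card_set1.
apply/seteqP; split => [_ [[|n] [c [w [Aw ->]]]]|_ ->]; last exact: span0.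
  by rewrite big_ord0.
by case: (Aw ord0).
Qed.

(** The vectors of the larger span are c x + v with v in span A, and c and v are
determined by the sum because x is not in span A. *)
Lemma card_spanU1 A x s : linear_span A #= `I_s -> ~ linear_span A x ->
  linear_span (A `|` [set x]) #= `I_(#|F| * s).
Proof.
move=> /card_eq_enum [e inje eA] nx.
pose f (p : F * 'I_s) := p.1 *: x + e p.2.
have Ae i : linear_span A (e i) by rewrite -eA; exists i.
have -> : linear_span (A `|` [set x]) = range f.
  rewrite spanU1 -eA; apply/seteqP; split => [_ [c _ [_ [i _ <-] <-]]|_ [[c i] _ <-]].
    by exists (c, i).
  by exists c => //; exists (e i) => //; exists i.
have -> : (#|F| * s = #|{: F * 'I_s}|)%N by rewrite card_prod card_ord.
apply: card_eq_range => -[c i] [d j]; rewrite /f /= => E.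
have Ecd : (c - d) *: x = e j - e i.
  by rewrite scalerBl; apply/eqP; rewrite subr_eq addrAC eq_sym subr_eq E addrC.
have cd : c = d.
  apply/eqP; rewrite -subr_eq0; apply/negPn/negP => cd0; apply: nx.
  have -> : x = (c - d)^-1 *: (- 1 *: e i + e j) + 0.
    by rewrite addr0 scaleN1r [X in _ *: X]addrC -Ecd scalerA mulVf // scale1r.
  by apply: span_linear (span0 _); exact: span_linear.
by rewrite cd in E *; congr (_, _); apply: inje; exact: addrI E.
Qed.

End Span.

(** * Algebraic closure of a tuple *)

Section AlgebraicClosure.
Local Open Scope card_scope.
Variable V : vocabulary.

Lemma range_tnth_cons (A : Type) k (x : A) (t : k.-tuple A) :
  range (tnth (cons_tuple x t)) = range (tnth t) `|` [set x].
Proof.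
apply/seteqP; split => [_ [i _ <-]|y [[i _ <-]|->]].
- have [j ->|->] := unliftP ord0 i; last by right; exact: (tnth0 x t).
  by left; exists j => //; rewrite (tnthS x t).
- by exists (lift ord0 i) => //; exact: (tnthS x t).
- by exists ord0 => //; exact: (tnth0 x t).
Qed.

(** A parameter tuple from the entries of t, with repetitions and omissions, is
a renaming of t; so formulas with exactly the parameters t suffice. *)
Lemma acl_tupleP (M : structure V) k (t : k.-tuple M) b :
  acl (range (tnth t)) b <->
  exists phi : formula V k.+1,
    finite_set [set x | sat phi (cons_tuple x t)] /\ sat phi (cons_tuple b t).
Proof.
split => [[n [phi [a [at_ fin H]]]]|[phi [fin H]]]; last first.
  by exists k, phi, t; split => // i; exists i.
have [f fP] : {f : 'I_n -> 'I_k | forall i, tnth t (f i) = tnth a i}.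
  exists (fun i => projT1 (cid2 (at_ i))) => i; by case: cid2.
have ta : map_tuple (tnth t) (mktuple f) = a.
  by apply: eq_from_tnth => i; rewrite tnth_map tnth_mktuple fP.
have E x : sat (rename phi (cons_tuple ord0 (lift_vars (mktuple f)))) (cons_tuple x t) <->
    sat phi (cons_tuple x a).
  by rewrite sat_rename map_tuple_cons map_tnth_up ta (tnth0 x t).
exists (rename phi (cons_tuple ord0 (lift_vars (mktuple f)))); split; last exact/E.
by apply: sub_finite_set fin => x /E.
Qed.

Lemma algebraic_sub_acl (M : structure V) k (t : k.-tuple M) (phi : formula V k.+1) s :
  [set y | sat phi (cons_tuple y t)] #= `I_s ->
  [set y | sat phi (cons_tuple y t)] `<=` acl (range (tnth t)).
Proof.
move=> phis y yP; apply/acl_tupleP; exists phi; split => //.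
by apply/finite_setP; exists s.
Qed.

(** Each point of the closure lies in a finite set definable over t, which is
contained in the closure; the union of these sets over the finitely many
points is the closure. *)
Lemma acl_definable (M : structure V) k (t : k.-tuple M) s :
  acl (range (tnth t)) #= `I_s ->
  exists phi : formula V k.+1,
    [set y | sat phi (cons_tuple y t)] = acl (range (tnth t)).
Proof.
move=> /card_eq_enum [e inje eA].
have [f fP] : {f : nat -> formula V k.+1 | forall i : 'I_s,
    finite_set [set x | sat (f i) (cons_tuple x t)] /\ sat (f i) (cons_tuple (e i) t)}.
  have H (i : 'I_s) : exists phi : formula V k.+1,
    finite_set [set x | sat phi (cons_tuple x t)] /\ sat phi (cons_tuple (e i) t).
    by apply/acl_tupleP; rewrite -eA; exists i.
  exists (fun j => if insub j is Some i then sval (cid (H i)) else Bot) => i.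
  by rewrite valK; case: cid.
exists (BigOr s f); apply/seteqP; split => x /=.
  move=> /sat_BigOr [j js jx]; apply/acl_tupleP; exists (f j).
  by split => //; have [] := fP (Ordinal js).
by rewrite -eA => -[i _ <-]; apply/sat_BigOr; exists i => //; have [] := fP i.
Qed.

(** The type of t says that chi has s solutions over t, and that each formula
with a given finite number of solutions over t has all of them among those of
chi. *)
Lemma acl_type_invariant (A B : structure V) k (t : k.-tuple A) (u : k.-tuple B)
    (chi : formula V k.+1) s :
  (forall phi : formula V k, sat phi t <-> sat phi u) ->
  [set y | sat chi (cons_tuple y t)] = acl (range (tnth t)) ->
  acl (range (tnth t)) #= `I_s ->
  [set y | sat chi (cons_tuple y u)] = acl (range (tnth u)) /\
  acl (range (tnth u)) #= `I_s.
Proof.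
move=> tu chit ts.
have chiu : [set y | sat chi (cons_tuple y u)] #= `I_s.
  by apply/sat_Count/tu/sat_Count; rewrite chit.
suff E : [set y | sat chi (cons_tuple y u)] = acl (range (tnth u)) by rewrite -E.
apply/seteqP; split; first exact: algebraic_sub_acl chiu.
move=> y /acl_tupleP [phi [/finite_setP [n /sat_Count/tu/sat_Count phin]]].
have /tu : sat (All (Imp phi chi)) t.
  move=> x /= phix; suff : [set y | sat chi (cons_tuple y t)] x by [].
  by rewrite chit; apply: algebraic_sub_acl phin _ phix.
by move=> /(_ y).
Qed.

(** Under a further binder w, in the context (w, y, x, parameters), this is
theta evaluated at w and the variable i: y for i = 1 and x for i = 2. *)
Definition set_second_var k (theta : formula V k.+2) (i : 'I_k.+3) : formula V k.+3 :=
  rename theta (cons_tuple ord0 (cons_tuple i (lift_vars (lift_vars (lift_vars (ord_tuple k)))))).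

(** The relation that two points have the same fibre in theta.  It is an
equivalence relation whatever theta is, so this need not be expressed in the
sentence transferred to the finite structures. *)
Definition Same k (theta : formula V k.+2) : formula V k.+2 :=
  All (Iff (set_second_var theta (lift ord0 ord0))
           (set_second_var theta (lift ord0 (lift ord0 ord0)))).

Lemma sat_Same (M : structure V) k (theta : formula V k.+2) (e : k.-tuple M) x y :
  sat (Same theta) (cons_tuple y (cons_tuple x e)) <->
  [set w | sat theta (cons_tuple w (cons_tuple y e))] =
  [set w | sat theta (cons_tuple w (cons_tuple x e))].
Proof.
have E w i : sat (set_second_var theta i) (cons_tuple w (cons_tuple y (cons_tuple x e)))
    <-> sat theta (cons_tuple w (cons_tuple
          (tnth (cons_tuple w (cons_tuple y (cons_tuple x e))) i) e)).
  by rewrite sat_rename !map_tuple_cons !map_tnth_up map_tnth_id (tnth0 w).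
have Ey w : tnth (cons_tuple w (cons_tuple y (cons_tuple x e))) (lift ord0 ord0) = y.
  by rewrite (tnthS w (cons_tuple y (cons_tuple x e))); exact: tnth0.
have Ex w : tnth (cons_tuple w (cons_tuple y (cons_tuple x e)))
    (lift ord0 (lift ord0 ord0)) = x.
  rewrite (tnthS w (cons_tuple y (cons_tuple x e))) (tnthS y (cons_tuple x e)).
  exact: tnth0.
split => [H|H w].
  by apply/seteqP; split => w /=; have /sat_Iff := H w; rewrite !E Ey Ex => -[].
apply/sat_Iff; rewrite !E Ey Ex.
by split; [have /seteqP [+ _] := H|have /seteqP [_ +] := H]; apply.
Qed.

End AlgebraicClosure.

(** * Uniform definability of the closure *)

Section UniformDefinability.
Local Open Scope card_scope.
Variables (V : vocabulary) (T : theory V) (M : structure V).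
Hypotheses (omega : omega_categorical T) (MT : models M T).
Hypothesis acl_pregeometry : pregeometry (@acl V M).
Variable q : nat.
Hypothesis q_gt1 : (1 < q)%N.
Hypothesis acl_step : forall (A : set M) x s,
  acl A #= `I_s -> ~ acl A x -> acl (A `|` [set x]) #= `I_(q * s).

Lemma acl_step_tuple k (t : k.-tuple M) x s :
  acl (range (tnth t)) #= `I_s -> ~ acl (range (tnth t)) x ->
  acl (range (tnth (cons_tuple x t))) #= `I_(q * s).
Proof. by rewrite range_tnth_cons; exact: acl_step. Qed.

(** Any formula with exactly q s solutions over (x, a) defines acl(x, a) if x
is not in acl(a), and there is no such formula if x is in acl(a), where
acl(x, a) = acl(a) has only s points.  Hence the disjunction theta over
finitely many formulas phi_j of: phi_j has q s solutions over (x, a), and y is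
one of them, behaves as stated as soon as the phi_j suffice for all x.  If no
finite number sufficed, saturation of B would give an x over a copy b of a
that escapes every formula; moving (x, b) back to M produces a point x'
outside the closure of a copy a' of a for which acl(x', a') has no defining
formula, against [acl_definable]. *)
Lemma acl_uniformly_definable (B : structure V) k (a : k.-tuple M) s :
  models B T ->
  (forall (b : k.-tuple B) (psi : nat -> formula V k.+1),
    (forall m, exists x, forall j, (j < m)%N -> sat (psi j) (cons_tuple x b)) ->
    exists x, forall j, sat (psi j) (cons_tuple x b)) ->
  (0 < s)%N -> acl (range (tnth a)) #= `I_s ->
  exists theta : formula V k.+2, forall x,
    (acl (range (tnth a)) x ->
     [set y | sat theta (cons_tuple y (cons_tuple x a))] = set0) /\
    (~ acl (range (tnth a)) x ->
     [set y | sat theta (cons_tuple y (cons_tuple x a))] =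
     acl (range (tnth (cons_tuple x a)))).
Proof.
move=> BT satB s0 acls; have [aclP acl_mono _ _] := acl_pregeometry.
have [chi chia] := acl_definable acls.
have [b ab] := type_transfer a omega MT BT.
pose fm j : formula V k.+2 := if unpickle j is Some t then decode_formula V t k.+2 else Bot.
have fmE phi : exists j, fm j = phi.
  by have [t tE] := decode_formula_surj phi; exists (pickle t); rewrite /fm pickleK.
pose good j := Or chi (Count (q * s) (fm j)).
(* Compactness in B: finitely many [good j] cover all points over b. *)
have [m mP] : exists m, forall x, exists2 j, (j < m)%N & sat (good j) (cons_tuple x b).
  apply: contrapT => nm.
  have [|x xP] := satB b (fun j => Not (good j)).
    move=> m; apply: contrapT => H; apply: nm; exists m => x.
    apply: contrapT => H1; apply: H; exists x => j jm /= gj.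
    by apply: H1; exists j.
  have [u uP] := type_transfer (cons_tuple x b) omega BT MT.
  (* Bring the point that escapes every formula, together with b, back to M. *)
  case/tupleP: u uP => x' a' uP; rewrite -[[tuple of _]]/(cons_tuple x' a') in uP.
  have aa' (phi : formula V k) : sat phi a <-> sat phi a'.
    rewrite ab; have := uP (rename phi (lift_vars (ord_tuple k))).
    by rewrite !sat_rename !map_tnth_up !map_tnth_id.
  have [chia' acls'] := acl_type_invariant aa' chia acls.
  have nx' : ~ acl (range (tnth a')) x'.
    by rewrite -chia' => /= /uP chix; have [j _] := fmE Bot; apply: (xP j); apply/sat_Or; left.
  have aclx' := acl_step_tuple acls' nx'.
  have [phi phiE] := acl_definable aclx'; have [j jE] := fmE phi.
  apply: (xP j); apply/sat_Or; right; rewrite jE; apply/uP/sat_Count.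
  by rewrite phiE.
exists (BigOr m (fun j => And (rename (Count (q * s) (fm j)) (lift_vars (ord_tuple k.+1))) (fm j))).
have mMP : sat (All (BigOr m good)) a.
  by apply/ab => x; apply/sat_BigOr; exact: mP.
have thetaE x y : sat (BigOr m (fun j => And (rename (Count (q * s) (fm j))
    (lift_vars (ord_tuple k.+1))) (fm j))) (cons_tuple y (cons_tuple x a)) <->
  exists j, [/\ (j < m)%N, [set y | sat (fm j) (cons_tuple y (cons_tuple x a))] #= `I_(q * s)
     & sat (fm j) (cons_tuple y (cons_tuple x a))].
  split => [/sat_BigOr [j jm /sat_And [H1 H2]]|[j [jm H1 H2]]].
    exists j; split => //.
    by move: H1; rewrite sat_rename map_tnth_up map_tnth_id sat_Count.
  apply/sat_BigOr; exists j => //; apply/sat_And; split => //.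
  by rewrite sat_rename map_tnth_up map_tnth_id sat_Count.
move=> x; split => xa.
  rewrite -subset0 => y /thetaE [j [_ H _]].
  have sub : acl (range (tnth (cons_tuple x a))) `<=` acl (range (tnth a)).
    rewrite range_tnth_cons -(aclP (range (tnth a))).2; apply: acl_mono.
    by move=> z [az|->//]; apply: (aclP _).1.
  have := card_eq_sub (subset_trans (algebraic_sub_acl H) sub) H acls.
  by rewrite leqNgt -[X in (X < _)%N]mul1n ltn_pmul2r // q_gt1.
have aclx := acl_step_tuple acls xa.
apply/seteqP; split => y.
  by move=> /thetaE [j [_ H yj]]; exact: algebraic_sub_acl H _ yj.
move=> ay; apply/thetaE; have /sat_BigOr [j jm /sat_Or [chix|/sat_Count H]] := mMP x.
  by case: xa; rewrite -chia.
exists j; split => //; suff : [set y | sat (fm j) (cons_tuple y (cons_tuple x a))] y by [].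
by rewrite (card_eq_subset_eq (algebraic_sub_acl H) H aclx).
Qed.

End UniformDefinability.

(** * The definable partition *)

Section Conclusion.
Local Open Scope card_scope.

(** Only the sizes of closures are carried over from the vector space: adding
a point outside a finite closure multiplies its size by the order of the
field. *)
Lemma acl_transport (V : vocabulary) (M : structure V) (F : finFieldType)
    (W : lmodType F) : pregeometry_iso (@acl V M) (@linear_span F W) ->
  acl (set0 : set M) #= `I_1 /\
  forall (A : set M) x s, acl A #= `I_s -> ~ acl A x ->
    acl (A `|` [set x]) #= `I_(#|F| * s).
Proof.
move=> [f [g fK gK] fcl].
have cardE A s : (acl A #= `I_s) = (linear_span (f @` A) #= `I_s).
  rewrite -fcl; apply: card_eql; rewrite card_eq_sym.
  by apply: inj_card_eq => x y _ _ /(can_inj fK).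
split; first by rewrite cardE image_set0; exact: card_span0.
move=> A x s; rewrite !cardE image_setU image_set1 => As nx.
by apply: card_spanU1 => //; rewrite -fcl => -[y Ay /(can_inj fK) yx]; rewrite yx in Ay.
Qed.

Lemma exists_independent (V : vocabulary) (M : structure V) q k :
  infinite_set [set: M] -> acl (set0 : set M) #= `I_1 ->
  (forall (A : set M) x s, acl A #= `I_s -> ~ acl A x ->
    acl (A `|` [set x]) #= `I_(q * s)) ->
  exists a : k.-tuple M, acl (range (tnth a)) #= `I_(q ^ k).
Proof.
move=> infM acl0 acl_step; elim: k => [|k [a aP]].
  exists [tuple]; suff -> : range (tnth ([tuple] : 0.-tuple M)) = set0 by [].
  by rewrite -subset0 => x [i _ _]; case: i.
have [x nx] : exists x, ~ acl (range (tnth a)) x.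
  apply: contrapT => H; apply: infM; apply/finite_setP; exists (q ^ k)%N.
  suff -> : [set: M] = acl (range (tnth a)) by [].
  by apply/seteqP; split => // x _; apply: contrapT => nx; apply: H; exists x.
by exists (cons_tuple x a); rewrite range_tnth_cons expnS; exact: acl_step.
Qed.

Definition class_sizes V k d e (theta : formula V k.+2) : formula V k :=
  All (Or (Count d (Same theta)) (Count e (Same theta))).

(** Points of acl(a) all have the empty fibre, so acl(a) is one class.  A point
y outside acl(a) has the fibre acl(y, a), and this equals acl(x, a) exactly
when y belongs to acl(x, a), since both closures have q s points. *)
Lemma sat_class_sizes (V : vocabulary) (M : structure V) q k (a : k.-tuple M) s
    (theta : formula V k.+2) :
  pregeometry (@acl V M) ->
  (forall (A : set M) x s, acl A #= `I_s -> ~ acl A x ->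
    acl (A `|` [set x]) #= `I_(q * s)) ->
  acl (range (tnth a)) #= `I_s -> (0 < s)%N ->
  (forall x,
    (acl (range (tnth a)) x ->
     [set y | sat theta (cons_tuple y (cons_tuple x a))] = set0) /\
    (~ acl (range (tnth a)) x ->
     [set y | sat theta (cons_tuple y (cons_tuple x a))] =
     acl (range (tnth (cons_tuple x a))))) ->
  sat (class_sizes s (q * s - s) theta) a.
Proof.
move=> [aclP acl_mono _ _] acl_step acls s0 thetaP x.
have acl_self z : acl (range (tnth (cons_tuple z a))) z.
  by apply: (aclP _).1; rewrite range_tnth_cons; right.
have acl_incl z : acl (range (tnth a)) `<=` acl (range (tnth (cons_tuple z a))).
  by apply: acl_mono; rewrite range_tnth_cons; left.
have E : [set y | sat (Same theta) (cons_tuple y (cons_tuple x a))] =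
    [set y | [set w | sat theta (cons_tuple w (cons_tuple y a))] =
             [set w | sat theta (cons_tuple w (cons_tuple x a))]].
  by apply/seteqP; split => y /sat_Same.
have [xa|xa] := pselect (acl (range (tnth a)) x); apply/sat_Or; [left|right];
  apply/sat_Count; rewrite E.
  rewrite ((thetaP x).1 xa).
  suff -> : [set y | [set w | sat theta (cons_tuple w (cons_tuple y a))] = set0] =
    acl (range (tnth a)) by [].
  apply/seteqP; split => y /=; last exact: (thetaP y).1.
  move=> y0; apply: contrapT => ya.
  by have := acl_self y; rewrite -((thetaP y).2 ya) y0.
rewrite ((thetaP x).2 xa).
have step z : ~ acl (range (tnth a)) z ->
    acl (range (tnth (cons_tuple z a))) #= `I_(q * s).
  by rewrite range_tnth_cons; exact: acl_step.
suff -> : [set y | [set w | sat theta (cons_tuple w (cons_tuple y a))] =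
    acl (range (tnth (cons_tuple x a)))] =
    acl (range (tnth (cons_tuple x a))) `\` acl (range (tnth a)).
  exact: card_eqD (acl_incl x) acls (step x xa).
apply/seteqP; split => y /=.
  have [ya|ya] := pselect (acl (range (tnth a)) y).
    rewrite ((thetaP y).1 ya) => e0.
    by have := acl_self x; rewrite -e0.
  by rewrite ((thetaP y).2 ya) => <-; split.
move=> [yx ya]; rewrite ((thetaP y).2 ya).
apply: card_eq_subset_eq (step y ya) (step x xa).
rewrite -[X in _ `<=` X](aclP _).2; apply: acl_mono.
rewrite range_tnth_cons => _ [[i _ <-]|->//].
by apply: acl_incl; apply: (aclP _).1; exists i.
Qed.

Lemma dvdn_card_classes (J : finType) (S : Type) (f : J -> S) d :
  (forall x, exists2 n, (d %| n)%N & [set y | f y = f x] #= `I_n) -> (d %| #|J|)%N.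
Proof.
move=> H; pose r x y := `[< f x = f y >].
have eqr : {in [set: J]%SET & &, equivalence_rel r}.
  move=> x y z _ _ _; split; first exact/asboolP.
  by move=> /asboolP xy; rewrite /r xy.
rewrite -cardsT (card_partition (equivalence_partitionP eqr)).
apply: dvdn_sum => A /imsetP [x _ ->].
have [n dn xn] := H x; suff rn : #|[pred y | r x y]| = n.
  rewrite -rn in dn; suff -> : #|[set y in [set: J]%SET | r x y]%SET| = #|[pred y | r x y]| by [].
  by apply: eq_card => y; rewrite !inE.
apply: card_eq_finType; suff -> : [set y | r x y] = [set y | f y = f x] by [].
by apply/seteqP; split => y /= => [/asboolP ->//|e]; exact/asboolP.
Qed.

Lemma dvdn_class_sizes (V : vocabulary) (N : finStructure V) k
    (b : k.-tuple (N : structure V)) (theta : formula V k.+2) c d e :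
  (c %| d)%N -> (c %| e)%N -> sat (class_sizes d e theta) b -> (c %| #|N|)%N.
Proof.
move=> cd ce sizes; pose N' : structure V := N.
apply: (@dvdn_card_classes N _ (fun x : N' =>
  [set w : N' | sat theta (cons_tuple w (cons_tuple x b))])) => x.
have E : [set y : N' | sat (Same theta) (cons_tuple y (cons_tuple (x : N') b))] =
    [set y : N' | [set w : N' | sat theta (cons_tuple w (cons_tuple y b))] =
                  [set w : N' | sat theta (cons_tuple w (cons_tuple (x : N') b))]].
  by apply/seteqP; split => y /sat_Same.
have /sat_Or [/sat_Count H|/sat_Count H] := sizes x; rewrite E in H.
  by exists d.
by exists e.
Qed.

Lemma finField_card (F : finFieldType) :
  exists p m, [/\ prime p, (0 < m)%N & #|F| = (p ^ m)%N].
Proof.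
have [p pr_p pF] := finPcharP F.
have E := card_pprimeChar pF; exists p, (logn p #|F|); split => //.
rewrite lt0n; apply/negP => /eqP m0; have := finNzRing_gt1 F.
by rewrite E m0.
Qed.

End Conclusion.

Theorem corollary3p5 (R : realType) (V : vocabulary)
    (K : random_structures R V)
    (size_grows : forall k : nat, almost_surely K (fun N => k <= #|N|))
    (omega_cat : omega_categorical (almost_sure_theory K))
    (M : structure V) (M_model : models M (almost_sure_theory K))
    (M_pregeometry : pregeometry (@acl V M))
    (F : finFieldType) (W : lmodType F)
    (M_iso : pregeometry_iso (@acl V M) (@linear_span F W)) :
  exists p m : nat,
    [/\ prime p, 0 < m &
        forall n : nat, 0 < n ->
          almost_surely K (fun N => p ^ (m * n) %| #|N|)].
Proof.
have [acl0 acl_step] := acl_transport M_iso.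
have [p [m [pr_p m0 Fpm]]] := finField_card F; exists p, m; split => // k _.
rewrite expnM -Fpm; have F_gt1 := finNzRing_gt1 F.
have [noFin _ _] := omega_cat.
have [a acla] := exists_independent k (noFin M M_model) acl0 acl_step.
apply: contrapT => nD.
have [I [N [rho [U [UU [pt] rhoU nDU asU]]]]] :=
  counterexample_ultrafilter size_grows nD.
pose B := ultraproduct (fun i => N i : structure V) U.
have B_model : models B (almost_sure_theory K).
  move=> phi /asU phiU; apply/(Los pt UU); apply: filterS phiU => i.
  rewrite /holds; congr (sat phi _); exact: val_inj.
have Fk_gt0 : 0 < #|F| ^ k by rewrite expn_gt0 (ltnW F_gt1).
have [theta thetaP] := acl_uniformly_definable omega_cat M_model M_pregeometry
  F_gt1 acl_step B_model
  (fun b psi => ultraproduct_saturated pt UU (b := b) (psi := psi) rhoU) Fk_gt0 acla.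
have Ma := sat_class_sizes M_pregeometry acl_step acla Fk_gt0 thetaP.
have [b ab] := type_transfer a omega_cat M_model B_model.
move/ab/(Los pt UU): Ma => bU.
have [i /= [nDi sati]] := filter_ex (filterI nDU bU).
by apply/nDi/(dvdn_class_sizes _ _ sati); rewrite ?dvdn_sub ?dvdn_mull.
Qed.
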